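(* Let $n\ge k\ge r$, where $d$ and $r$ are non-negative integers with $r>d$. Then ${n\brace k}_{r,d}$ satisfies the recurrence relation $${n\brace k}_{r,d} = {n-1\brace k-1}_{r,d} + (k-d)\,{n-1\brace k}_{r,d},$$ with ${0\brace 0}_{r,d}=1$, ${n\brace k}_{r,d}=0$ for $k<r$, and ${r\brace r}_{r,d}=1$.
   Context: ${n\brace k}_{r,d}$ (the $(r,d)$-Stirling number of the second kind) denotes the number of ways to partition the set $\{1,\dots,n\}$ of $n$ elements into $k$ non-empty subsets such that the first $r$ elements $1,\dots,r$ lie in different subsets and any two elements $i\neq j$ within the same subset satisfy $|i-j|>d$.
   Formalization: The vanishing for k<r is stated only for n≠k, since at n=k<r the value is 1 (e.g. n=k=0, where the statement itself says 1); for n<r, the condition on the first r elements is applied to the elements that exist. *)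

(* Defs.v *)
From mathcomp Require Import all_boot all_order all_algebra.

Set Implicit Arguments.
Unset Strict Implicit.
Unset Printing Implicit Defensive.

(* The element i of {1, ..., n} is represented by the ordinal of value i - 1,
   so the elements 1, ..., r are the ordinals of value < r.  When n < r, the
   condition on the first r elements bears on all the elements of {1, ..., n}. *)
Definition first_separated (n r : nat) (P : {set {set 'I_n}}) : bool :=
  [forall B in P, forall i in B, forall j in B,
     (i < r) && (j < r) ==> (i == j)].

Definition distance_separated (n d : nat) (P : {set {set 'I_n}}) : bool :=
  [forall B in P, forall i in B, forall j in B,
     (i != j) ==> (d < `|i - j|)].

Definition rd_partitions (n k r d : nat) : {set {set {set 'I_n}}} :=
  [set P | [&& partition P [set: 'I_n], #|P| == k,
               first_separated r P & distance_separated d P]].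

Definition rd_stirling2 (n k r d : nat) : nat := #|rd_partitions n k r d|.

(* Main.v *)
Require Import Defs.
From mathcomp Require Import all_boot all_order all_algebra zify.

Set Implicit Arguments.
Unset Strict Implicit.
Unset Printing Implicit Defensive.

(** Call two elements of {1, ..., n} in conflict when both are at most r or when
    their distance is at most d.  The partitions counted by the
    (r, d)-Stirling number are then the partitions of the vertex set of the
    conflict graph into stable (independent) blocks, so everything reduces to
    counting stable partitions of a graph.

    For an arbitrary graph, add a new vertex x to a vertex set A.  In a stable
    partition of A with x added, either x is alone, and deleting its block
    leaves a stable partition of A with one block fewer; or x was put into a
    block B of a stable partition of A with the same number of blocks, where B
    contains no neighbour of x ([card_stable_partitions_setU1]).  If the
    neighbours of x in A form a clique K, they lie in #|K| different blocks of
    any stable partition of A, so exactly #|K| blocks are forbidden for x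
    ([card_free_blocks]).

    For x = n + 1 with n at least r and d, the neighbours of x are the d
    integers n - d + 1, ..., n; they are in conflict with each other because
    they are within distance d.  Hence the factor k - d
    ([rd_stirling2_rec]).

    The boundary values come from the same tools: a clique with more than k
    vertices rules out stable partitions into k blocks, which handles k < r
    through the clique {1, ..., min(n, r)}; there are no partitions of n
    elements into more than n blocks; and the recurrence on A shows that there
    is one stable partition of A into #|A| blocks.  This last fact also settles
    n = k = r, the only case of the recurrence in which the last element is
    one of the first r. *)

(** * Stable partitions of a graph *)

Section StablePartitions.

Variables (T : finType) (e : rel T).
Implicit Types (x y : T) (A B K : {set T}) (P Q : {set {set T}}).

Definition stable B := [forall x in B, forall y in B, (x != y) ==> ~~ e x y].

Definition clique K := [forall x in K, forall y in K, (x != y) ==> e x y].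

Definition stable_partitions A k : {set {set {set T}}} :=
  [set P | [&& partition P A, #|P| == k & [forall B in P, stable B]]].

(** The blocks of [P] to which [x] can be added while keeping them stable. *)
Definition free_blocks x P := [set B in P | [forall y in B, ~~ e x y]].

Lemma stableP B :
  reflect {in B &, forall x y, x != y -> ~~ e x y} (stable B).
Proof.
apply: (iffP forall_inP) => [H x y xB yB|H x xB].
  by move: (H x xB) => /forall_inP/(_ y yB)/implyP.
by apply/forall_inP => y yB; apply/implyP; apply: H.
Qed.

Lemma cliqueP K : reflect {in K &, forall x y, x != y -> e x y} (clique K).
Proof.
apply: (iffP forall_inP) => [H x y xB yB|H x xB].
  by move: (H x xB) => /forall_inP/(_ y yB)/implyP.
by apply/forall_inP => y yB; apply/implyP; apply: H.
Qed.

Lemma stable_partitionsP P A k :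
  reflect [/\ partition P A, #|P| = k & {in P, forall B, stable B}]
          (P \in stable_partitions A k).
Proof.
rewrite inE; apply: (iffP and3P) => [[pP /eqP cP /forall_inP sP]|[pP cP sP]].
  by [].
by split=> //; [apply/eqP | apply/forall_inP].
Qed.

Lemma stable_sub B B' : B' \subset B -> stable B -> stable B'.
Proof.
move=> /subsetP sB /stableP stB; apply/stableP => x y xB yB.
by apply: stB; apply: sB.
Qed.

Lemma stable1 x : stable [set x].
Proof. by apply/stableP => y z /set1P-> /set1P->; rewrite eqxx. Qed.

Lemma stable_setU1 x B : symmetric e -> stable B ->
  {in B, forall y, ~~ e x y} -> stable (x |: B).
Proof.
move=> esym /stableP sB xB; apply/stableP => y z.
case/setU1P=> [->|yB] /setU1P[->|zB]; rewrite ?eqxx // => yz.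
- exact: xB.
- by rewrite esym; apply: xB.
- exact: sB.
Qed.

Lemma card_partition_leq P A : partition P A -> #|P| <= #|A|.
Proof.
move=> pP; rewrite (card_partition pP) -sum1_card; apply: leq_sum => B BP.
by rewrite card_gt0 (partition_neq0 pP BP).
Qed.

(** A stable block holds at most one vertex of a clique, so sending a vertex to
    its block is a bijection from [K] onto the blocks that meet [K]. *)
Lemma card_blocks_meeting_clique P A K : partition P A ->
  {in P, forall B, stable B} -> K \subset A -> clique K ->
  #|[set B in P | B :&: K != set0]| = #|K|.
Proof.
move=> pP sP /subsetP KA /cliqueP cK.
have tP := partition_trivIset pP; have cP := cover_partition pP.
rewrite -(@card_in_imset _ _ (pblock P) K); last first.
  move=> x y xK yK eq_xy; apply: contraTeq isT => xy.
  have xb : x \in pblock P x by rewrite mem_pblock cP KA.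
  have yb : y \in pblock P x by rewrite eq_xy mem_pblock cP KA.
  have := sP _ (pblock_mem (_ : x \in cover P)); rewrite cP KA // => /(_ isT).
  by move/stableP/(_ x y xb yb xy); rewrite (cK _ _ xK yK xy).
apply: eq_card => B; rewrite inE; apply/andP/imsetP => [[BP]|[x xK ->]].
  by case/set0Pn=> x /setIP[xB xK]; exists x; rewrite ?(def_pblock tP BP xB).
rewrite pblock_mem ?cP ?KA //; split=> //; apply/set0Pn; exists x.
by rewrite inE xK mem_pblock cP KA.
Qed.

Lemma card_clique_leq P A K k : P \in stable_partitions A k ->
  K \subset A -> clique K -> #|K| <= k.
Proof.
case/stable_partitionsP=> pP <- sP KA cK.
rewrite -(card_blocks_meeting_clique pP sP KA cK); apply: subset_leq_card.
by apply/subsetP => B /setIdP[].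
Qed.

(** The blocks that are not free are those that meet the neighbourhood of [x];
    as this neighbourhood is a clique, they are as many as its vertices. *)
Lemma card_free_blocks x P A k : P \in stable_partitions A k ->
  clique [set y in A | e x y] ->
  #|free_blocks x P| = k - #|[set y in A | e x y]|.
Proof.
case/stable_partitionsP=> pP <- sP cK; set K := [set y in A | e x y].
have KA : K \subset A by apply/subsetP => y /setIdP[].
rewrite -(card_blocks_meeting_clique pP sP KA cK).
rewrite -[in RHS](cardsID (free_blocks x P) P).
have -> : P :&: free_blocks x P = free_blocks x P.
  by apply/setIidPr/subsetP => B /setIdP[].
rewrite -[LHS](addnK #|P :\: free_blocks x P|); congr (_ - _).
apply: eq_card => B; rewrite !inE.
have [BP /=|] := boolP (B \in P); last by rewrite andbF.
rewrite andbT negb_forall; apply/existsP/set0Pn => -[y].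
  rewrite negb_imply negbK => /andP[yB exy]; exists y; rewrite !inE yB exy.
  by rewrite (subsetP (partitionS pP BP)).
by rewrite !inE => /and3P[yB yA exy]; exists y; rewrite yB exy.
Qed.

(** * Adding a vertex *)

Section AddPoint.

Variables (x : T) (A : {set T}).
Hypotheses (esym : symmetric e) (xA : x \notin A).

(** The pair holds a partition and the block of it that receives [x]. *)
Definition insert_point (PB : {set {set T}} * {set T}) :=
  (x |: PB.2) |: (PB.1 :\ PB.2).

(** Inverse of [insert_point] on the partitions in which [x] is not alone: it
    also records the block from which [x] was taken. *)
Definition remove_point Q :=
  ((pblock Q x :\ x) |: (Q :\ pblock Q x), pblock Q x :\ x).

Definition pointed_partitions k : {set {set {set T}} * {set T}} :=
  [set PB | (PB.1 \in stable_partitions A k) && (PB.2 \in free_blocks x PB.1)].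

Let notin_block P B : partition P A -> B \in P -> x \notin B.
Proof. by move=> pP BP; apply: contra xA; apply/subsetP/(partitionS pP). Qed.

(** Deleting the block [[set x]] is inverse to adding it. *)
Lemma card_singleton_block k :
  #|[set Q in stable_partitions (x |: A) k.+1 | [set x] \in Q]| =
  #|stable_partitions A k|.
Proof.
have xP P : partition P A -> [set x] \notin P.
  by move=> pP; apply/negP => /(notin_block pP); rewrite inE eqxx.
rewrite -(@card_in_imset _ _ (fun P => [set x] |: P) (stable_partitions A k)).
  apply: eq_card => Q; rewrite inE.
  apply/andP/imsetP => [[/stable_partitionsP[pQ cQ sQ] xQ]|[P]].
    exists (Q :\ [set x]); last by rewrite setD1K.
    apply/stable_partitionsP; split.
    - by rewrite -(setU1K xA); apply: partitionD1.
    - by move: cQ; rewrite (cardsD1 [set x]) xQ => -[].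
    - by move=> B /setD1P[_ /sQ].
  case/stable_partitionsP=> pP cP sP ->; split; last exact: setU11.
  apply/stable_partitionsP; split.
  - apply: partitionU1 => //; last by rewrite disjoints1.
    by apply/set0Pn; exists x; rewrite inE.
  - by rewrite cardsU1 xP // cP.
  - by move=> B /setU1P[->|/sP //]; apply: stable1.
move=> P P' /stable_partitionsP[pP _ _] /stable_partitionsP[pP' _ _] eqP.
by rewrite -(setU1K (xP _ pP)) eqP (setU1K (xP _ pP')).
Qed.

(** The block of [x] is computed here because it is what [remove_point] reads
    off to recover the pair. *)
Lemma pblock_insert_point k PB : PB \in pointed_partitions k ->
  insert_point PB \in stable_partitions (x |: A) k /\
  pblock (insert_point PB) x = x |: PB.2.
Proof.
case: PB => P B; rewrite inE /=.
case/andP=> /stable_partitionsP[pP cP sP] /setIdP[BP /forall_inP xB].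
have xnP := notin_block pP.
have pI : partition (insert_point (P, B)) (x |: A).
  have -> : x |: A = (x |: B) :|: (A :\: B).
    by rewrite -setUA -[X in X :|: _ :\: _](setIidPr (partitionS pP BP)) setID.
  apply: partitionU1; first exact: partitionD1.
    by apply/set0Pn; exists x; rewrite setU11.
  rewrite disjoints_subset; apply/subsetP => y /setU1P[->|yB].
    by rewrite !inE negb_and xA orbT.
  by rewrite !inE yB.
split; last first.
  by apply: def_pblock (partition_trivIset pI) _ _; rewrite ?inE eqxx.
apply/stable_partitionsP; split=> //=.
- rewrite /insert_point /= cardsU1 -cP (cardsD1 B P) BP; congr (_ + _).
  apply/eqP; rewrite eqb1; apply/negP => /setD1P[_ /xnP].
  by rewrite setU11.
- move=> C /setU1P[->|/setD1P[_ /sP]] //.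
  by apply: stable_setU1 => //; apply: sP.
Qed.

Lemma remove_point_in k Q : Q \in stable_partitions (x |: A) k ->
  [set x] \notin Q -> remove_point Q \in pointed_partitions k.
Proof.
case/stable_partitionsP=> pQ cQ sQ xQ.
have xc : x \in cover Q by rewrite (cover_partition pQ) setU11.
have BQ := pblock_mem xc; have xB := mem_pblock Q x; rewrite xc in xB.
rewrite /remove_point; set B := pblock Q x in BQ xB *.
have BA := partitionS pQ BQ.
have B0 : B :\ x != set0.
  apply: contraNneq xQ => B0.
  by rewrite -(setD1K xB) B0 setU0 in BQ.
have disj : [disjoint B :\ x & (x |: A) :\: B].
  rewrite disjoints_subset; apply/subsetP => y /setD1P[_ yB].
  by rewrite !inE yB.
have pP : partition ((B :\ x) |: (Q :\ B)) A.
  have -> : A = (B :\ x) :|: ((x |: A) :\: B).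
    apply/setP => y; have := subsetP BA y; rewrite !inE.
    by case: eqP => [->|_]; case: (y \in B) (y \in A) => -[] //=;
      rewrite ?(negbTE xA) ?xB //= => /(_ isT).
  exact: partitionU1 (partitionD1 pQ BQ) B0 disj.
rewrite inE /=; apply/andP; split.
  apply/stable_partitionsP; split=> //.
  - rewrite cardsU1 -cQ (cardsD1 B Q) BQ; congr (_ + _); apply/eqP.
    rewrite eqb1; apply/negP => /(partitionS (partitionD1 pQ BQ)) sub.
    case/set0Pn: B0 => y yB; move: (subsetP sub y yB).
    by rewrite (disjointFr disj yB).
  - move=> C /setU1P[->|/setD1P[_ /sQ //]].
    by apply: stable_sub (sQ _ BQ); apply: subsetDl.
rewrite inE setU11 /=; apply/forall_inP => y /setD1P[yx yB].
by apply: (stableP _ (sQ _ BQ)) => //; rewrite eq_sym.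
Qed.

(** Removing the old block [B :\ x] again is harmless only because this set is
    not another block of [Q]: a nonempty proper subset of a block never is
    one. *)
Lemma remove_pointK Q k : Q \in stable_partitions (x |: A) k ->
  [set x] \notin Q -> insert_point (remove_point Q) = Q.
Proof.
move=> QS xQ; have := remove_point_in QS xQ; case/stable_partitionsP: QS.
move=> pQ _ _; rewrite inE => /andP[_ _].
have xc : x \in cover Q by rewrite (cover_partition pQ) setU11.
have BQ := pblock_mem xc; have xB := mem_pblock Q x; rewrite xc in xB.
rewrite /insert_point /= setD1K // setU1K ?setD1K //.
apply/negP => /setD1P[neq CQ].
have /trivIsetP/(_ _ _ CQ BQ neq) := partition_trivIset pQ.
have /set0Pn[y yC] := partition_neq0 pQ CQ.
move=> /disjointFr/(_ yC) yB.
by case/setD1P: yC; rewrite yB.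
Qed.

Lemma insert_pointK k :
  {in pointed_partitions k, cancel insert_point remove_point}.
Proof.
move=> PB PBE; have [_ pbx] := pblock_insert_point PBE.
move: PBE; rewrite /remove_point pbx /insert_point; case: PB {pbx} => P B.
rewrite inE /= => /andP[/stable_partitionsP[pP _ _] /setIdP[BP _]].
have xnP := notin_block pP.
rewrite setU1K ?xnP // setU1K ?setD1K //.
by apply/negP => /setD1P[_ /xnP]; rewrite setU11.
Qed.

(** [insert_point] and [remove_point] are mutually inverse bijections between
    pairs of a partition and a free block of it, and the partitions in which
    [x] has company. *)
Lemma card_no_singleton_block k :
  #|[set Q in stable_partitions (x |: A) k | [set x] \notin Q]| =
  \sum_(P in stable_partitions A k) #|free_blocks x P|.
Proof.
transitivity #|pointed_partitions k|.
  rewrite -(card_in_imset (can_in_inj (@insert_pointK k))).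
  apply: eq_card => Q; rewrite inE; apply/andP/imsetP => [[QS xQ]|[PB PBE ->]].
    by exists (remove_point Q);
      [apply: remove_point_in | rewrite (remove_pointK QS)].
  (* The block of x is x |: B with B nonempty, hence not a singleton. *)
  have [IS pbx] := pblock_insert_point PBE; split=> //; apply/negP => xI.
  have pI : partition (insert_point PB) (x |: A).
    by case/stable_partitionsP: IS.
  have := def_pblock (partition_trivIset pI) xI (set11 x); rewrite pbx.
  move: PBE; case: PB {IS pbx xI pI} => P B.
  rewrite inE /= => /andP[/stable_partitionsP[pP _ _] /setIdP[BP _]] xBx.
  have := partition_neq0 pP BP.
  by rewrite -(setU1K (notin_block pP BP)) xBx setDv eqxx.
rewrite -sum1_card; under [RHS]eq_bigr do rewrite -sum1_card.
by rewrite pair_big_dep /=; apply: eq_bigl => -[P B]; rewrite !inE.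
Qed.

(** The general recurrence: the two terms count the partitions in which [x] is
    alone and those in which it is not. *)
Lemma card_stable_partitions_setU1 k :
  #|stable_partitions (x |: A) k.+1| = #|stable_partitions A k| +
    \sum_(P in stable_partitions A k.+1) #|free_blocks x P|.
Proof.
rewrite -card_singleton_block -card_no_singleton_block.
rewrite -(cardsID [set Q : {set {set T}} | [set x] \in Q]
                  (stable_partitions (x |: A) k.+1)).
by congr (_ + _); apply: eq_card => Q; rewrite !inE // andbC.
Qed.

End AddPoint.

Lemma stable_partitions_large A k : #|A| < k -> stable_partitions A k = set0.
Proof.
move=> Ak; apply/setP => P; rewrite [RHS]inE; apply/negP.
case/stable_partitionsP=> /card_partition_leq le_PA cP _.
by move: Ak; rewrite -cP ltnNge le_PA.
Qed.

(** In the recurrence for adding a vertex, the second term counts partitions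
    into more blocks than there are points, so only the first one remains and
    the value 1 propagates from the empty set. *)
Lemma card_stable_partitions_diag A :
  symmetric e -> #|stable_partitions A #|A| | = 1.
Proof.
move=> esym; have [n] := ubnP #|A|; elim: n A => // n IHn A.
have [->|[x xA]] := set_0Vmem A => [_|].
  rewrite cards0 -(cards1 (set0 : {set {set T}})); apply: eq_card => P.
  rewrite !inE partition_set0; case: eqP => //= ->; rewrite cards0 eqxx.
  by apply/forall_inP => B; rewrite inE.
rewrite (cardsD1 x A) xA add1n ltnS => /IHn.
have xnA : x \notin A :\ x by rewrite setD11.
rewrite -[in stable_partitions A](setD1K xA).
rewrite card_stable_partitions_setU1 // => ->.
by rewrite stable_partitions_large ?big_set0.
Qed.

End StablePartitions.

(** Embedding a graph as an induced subgraph of another one does not change the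
    count.  This lets the vertex set of size [n] be seen inside ['I_n.+1]. *)
Lemma card_stable_partitions_imset (T T' : finType) (f : T -> T')
    (e : rel T) (e' : rel T') (A : {set T}) (k : nat) :
  injective f -> (forall x y, e' (f x) (f y) = e x y) ->
  #|stable_partitions e' (f @: A) k| = #|stable_partitions e A k|.
Proof.
move=> finj fe; set F := fun B : {set T} => f @: B.
have Finj : injective F := imset_inj finj.
have sF (B : {set T}) : stable e' (F B) = stable e B.
  apply/stableP/stableP => sB.
    move=> x y xB yB xy; rewrite -fe; apply: sB; rewrite ?imset_f //.
    by rewrite (inj_eq finj).
  move=> _ _ /imsetP[x xB ->] /imsetP[y yB ->]; rewrite (inj_eq finj) fe.
  exact: sB.
have SF (P : {set {set T}}) : (F @: P \in stable_partitions e' (f @: A) k) =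
            (P \in stable_partitions e A k).
  rewrite !inE imset_partition // card_imset //; congr [&& _, _ & _].
  apply/forall_inP/forall_inP => sP B.
    by move=> BP; rewrite -sF; apply: sP; rewrite imset_f.
  by case/imsetP=> C CP ->; rewrite sF; apply: sP.
rewrite -(card_imset _ (imset_inj Finj)); apply: eq_card => Q.
apply/idP/imsetP => [QS|[P PS ->]]; last by rewrite SF.
(* Every block of Q lies in the image of f, hence is the image of its
   preimage. *)
have QE : Q = F @: ((fun B : {set T'} => f @^-1: B) @: Q).
  rewrite -imset_comp -[LHS]imset_id; apply: eq_in_imset => B BQ /=.
  case/stable_partitionsP: QS => pQ _ _; have BA := partitionS pQ BQ.
  apply/setP => y; apply/idP/imsetP => [yB|[x]]; last by rewrite inE => ? ->.
  have /imsetP[x _ yx] := subsetP BA y yB.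
  by exists x; rewrite // inE -yx.
by exists ((fun B : {set T'} => f @^-1: B) @: Q); rewrite // -SF -QE.
Qed.

(** * The conflict graph on integers *)

Definition conflict (r d i j : nat) := (i < r) && (j < r) || (`|i - j| <= d).

Lemma conflict_sym r d : symmetric (conflict r d).
Proof. by move=> i j; rewrite /conflict; lia. Qed.

Lemma rd_stirling2E n k r d :
  rd_stirling2 n k r d =
  #|stable_partitions (relpre (@nat_of_ord n) (conflict r d)) setT k|.
Proof.
apply: eq_card => P; rewrite !inE; congr [&& _, _ & _].
apply/andP/forall_inP => [[fP dP] B BP|sP].
  apply/stableP => i j iB jB ij /=; rewrite /conflict negb_or -ltnNge.
  move/forall_inP/(_ B BP)/forall_inP/(_ i iB)/forall_inP/(_ j jB): fP.
  move/forall_inP/(_ B BP)/forall_inP/(_ i iB)/forall_inP/(_ j jB): dP.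
  by rewrite (negbTE ij) /= implybF => -> ->.
split; apply/forall_inP => B BP; apply/forall_inP => i iB;
  apply/forall_inP => j jB; have := stableP _ _ (sP B BP) i j iB jB;
  rewrite /= /conflict negb_or -ltnNge;
  by case: (i == j) => [_|/(_ isT)/andP[/negPf far_r far_d]];
    rewrite ?implybT ?far_r ?far_d.
Qed.

Lemma rd_stirling2_diag n r d : rd_stirling2 n n r d = 1.
Proof.
rewrite rd_stirling2E -[X in stable_partitions _ _ X](card_ord n) -cardsT.
by apply: card_stable_partitions_diag => i j; apply: conflict_sym.
Qed.

Lemma rd_stirling2_large n k r d : n < k -> rd_stirling2 n k r d = 0.
Proof.
move=> nk; rewrite rd_stirling2E stable_partitions_large ?cards0 //.
by rewrite cardsT card_ord.
Qed.

Lemma card_ord_interval n a b :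
  b <= n -> #|[set i : 'I_n | a <= i < b]| = b - a.
Proof.
move=> bn; rewrite cardE -(size_map val) -(size_iota a (b - a)).
apply: perm_size; apply: uniq_perm; rewrite ?iota_uniq //.
  by rewrite map_inj_uniq ?enum_uniq //; apply: val_inj.
move=> m; rewrite mem_iota; apply/mapP/idP => [[i]|].
  by rewrite mem_enum inE => /andP[ai ib] -> /=; lia.
move=> mab; have mn : m < n by lia.
by exists (Ordinal mn); rewrite // mem_enum inE /=; lia.
Qed.

(** The first [k.+1] elements are pairwise in conflict, so they need [k.+1]
    different blocks. *)
Lemma rd_stirling2_small n k r d :
  k < n -> k < r -> rd_stirling2 n k r d = 0.
Proof.
move=> kn kr; rewrite rd_stirling2E; apply/eqP; rewrite cards_eq0.
apply/negPn/negP => /set0Pn[P PS].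
have := card_clique_leq PS (subsetT [set i : 'I_n | 0 <= i < k.+1]).
rewrite card_ord_interval // subn0 ltnn => H; apply: notF; apply: H.
apply/cliqueP => i j; rewrite !inE /conflict /=; lia.
Qed.

(** As [r <= n], the last element conflicts with others only through the
    distance condition; as [d <= n], exactly [d] elements precede it within
    distance [d], and these are pairwise in conflict. *)
Lemma rd_stirling2_rec n k r d : r <= n -> d <= n ->
  rd_stirling2 n.+1 k.+1 r d =
  rd_stirling2 n k r d + (k.+1 - d) * rd_stirling2 n k.+1 r d.
Proof.
move=> rn dn; rewrite !rd_stirling2E.
set e := relpre (@nat_of_ord n.+1) _; pose A := lift ord_max @: [set: 'I_n].
have tr m : #|stable_partitions (relpre (@nat_of_ord n) (conflict r d))
                                setT m| =
            #|stable_partitions e A m|.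
  apply/esym/card_stable_partitions_imset; first exact: lift_inj.
  have bumpE (i : 'I_n) : bump n i = i := lift_max i.
  by move=> i j; rewrite /e /= !bumpE.
have AE (i : 'I_n.+1) : (i \in A) = (i < n).
  apply/imsetP/idP => [[j _ ->]|ltin]; first by rewrite lift_max.
  by exists (Ordinal ltin) => //; apply: val_inj; apply: esym; apply: lift_max.
have mA : ord_max \notin A by rewrite AE ltnn.
have -> : [set: 'I_n.+1] = ord_max |: A.
  apply/setP => i; rewrite !inE AE; apply/esym.
  by have := ltn_ord i; rewrite ltnS leq_eqVlt -val_eqE.
have KE : [set i in A | e ord_max i] = [set i : 'I_n.+1 | n - d <= i < n].
  by apply/setP => i; rewrite !inE AE /e /= /conflict /=; lia.
rewrite !tr card_stable_partitions_setU1 //; last first.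
  by move=> i j; apply: conflict_sym.
congr (_ + _); rewrite mulnC -sum_nat_const; apply: eq_bigr => P PS.
rewrite (card_free_blocks PS) KE.
  by rewrite card_ord_interval // subKn.
by apply/cliqueP => i j; rewrite !inE /e /= /conflict; lia.
Qed.

(* The values for k < r exclude n = k: there (for instance at n = k = 0) the
   partition into singletons gives 1 and not 0. *)
Theorem theorem1p3 (d r : nat) (hdr : d < r) :
  [/\ forall n k : nat, r <= k -> k <= n ->
        rd_stirling2 n k r d =
          rd_stirling2 n.-1 k.-1 r d + (k - d) * rd_stirling2 n.-1 k r d,
      rd_stirling2 0 0 r d = 1,
      forall n k : nat, k < r -> n <> k -> rd_stirling2 n k r d = 0
    & rd_stirling2 r r r d = 1].
Proof.
split=> [n k rk kn||n k kr nk|]; rewrite ?rd_stirling2_diag //.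
  case: k rk kn => [|k] rk kn; first by lia.
  case: n kn => [//|n] kn /=.
  (* On the diagonal r <= n may fail for the smaller size n, so
     rd_stirling2_rec does not always apply; both sides equal 1. *)
  have [->|nk] := eqVneq n k.
    by rewrite !rd_stirling2_diag rd_stirling2_large // muln0.
  by apply: rd_stirling2_rec; lia.
have [ltkn|] := ltnP k n; first exact: rd_stirling2_small.
by rewrite leq_eqVlt => /predU1P[//|]; apply: rd_stirling2_large.
Qed.
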